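(* The spectrum of nim numbers of avoidance games with $\tau(W)\subseteq\mathrm{Ex}(S)$ is $\{0,1\}$; that is, the set of all values $\mathrm{nim}(\mathrm{DNG}(S,W))$, where $(S,\mathcal{K})$ ranges over all convex geometries and $W$ over all nonempty subsets of $S$ with $\tau(W)\subseteq\mathrm{Ex}(S)$, equals $\{0,1\}$.
   Context: A convex geometry is a pair $(S,\mathcal{K})$ with $S$ a finite set and $\mathcal{K}$ a family of subsets of $S$ such that: (1) $S\in\mathcal{K}$; (2) $K,L\in\mathcal{K}$ implies $K\cap L\in\mathcal{K}$; (3) if $S\neq K\in\mathcal{K}$, then there is $a\in S\setminus K$ with $K\cup\{a\}\in\mathcal{K}$. The convex closure operator is $\tau(A)=\bigcap\{K\in\mathcal{K}\mid A\subseteq K\}$ for $A\subseteq S$. A point $a\in A$ is an extreme point of $A$ if $a\notin\tau(A\setminus\{a\})$; $\mathrm{Ex}(A)$ is the set of extreme points of $A$. Avoidance game $\mathrm{DNG}(S,W)$, for nonempty $W\subseteq S$: two players alternately choose previously unchosen points of $S$, starting from the empty set of chosen points; a player may choose a point only if, with $P$ the set of all jointly chosen points after the move, $W\not\subseteq\tau(P)$. The last player able to move wins. The nim number of a position $P$ is defined recursively by $\mathrm{nim}(P)=\mathrm{mex}\{\mathrm{nim}(Q)\mid Q\in\mathrm{Opt}(P)\}$, where $\mathrm{Opt}(P)$ is the set of positions reachable from $P$ in one legal move and $\mathrm{mex}(A)$ is the smallest nonnegative integer not in $A$; the nim number of the game is that of its starting position $\emptyset$. *)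

(* Defs.v *)
From HB Require Import structures.
From mathcomp Require Import all_boot.

Set Implicit Arguments.
Unset Strict Implicit.
Unset Printing Implicit Defensive.

Record convex_geometry (S : finType) := ConvexGeometry {
  convex_sets :> {set {set S}};
  convex_setT : [set: S] \in convex_sets;
  convex_setI : forall K L : {set S},
    K \in convex_sets -> L \in convex_sets -> K :&: L \in convex_sets;
  convex_setU1 : forall K : {set S}, K \in convex_sets -> K != [set: S] ->
    exists2 a : S, a \notin K & a |: K \in convex_sets
}.

Definition tau (S : finType) (G : convex_geometry S) (A : {set S}) : {set S} :=
  \bigcap_(K in (G : {set {set S}}) | A \subset K) K.

Definition Ex (S : finType) (G : convex_geometry S) (A : {set S}) : {set S} :=
  [set a in A | a \notin tau G (A :\ a)].

Lemma mex_exists (s : seq nat) : exists n, n \notin s.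
Proof.
exists (\max_(i <- s) i).+1; apply/negP => sm.
by have := @leq_bigmax_seq _ s xpredT id _ sm isT; rewrite ltnn.
Qed.

Definition mex (s : seq nat) : nat := ex_minn (mex_exists s).

Definition Opt (S : finType) (G : convex_geometry S) (W P : {set S}) :
    {set {set S}} :=
  [set a |: P | a in ~: P & ~~ (W \subset tau G (a |: P))].

(* The fuel n bounds the number of moves still possible; #|~: P| suffices,    *)
(* and nimE shows that nim satisfies the unbounded recursion.                 *)
Fixpoint nim_rec (S : finType) (G : convex_geometry S) (W : {set S}) (n : nat)
    (P : {set S}) : nat :=
  if n is n'.+1 then mex [seq nim_rec G W n' Q | Q in Opt G W P] else 0.

Definition nim (S : finType) (G : convex_geometry S) (W P : {set S}) : nat :=
  nim_rec G W #|~: P| P.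

Lemma nimE (S : finType) (G : convex_geometry S) (W P : {set S}) :
  nim G W P = mex [seq nim G W Q | Q in Opt G W P].
Proof.
rewrite {1}/nim; case cP: #|~: P| => [|n] /=; last first.
  congr mex; apply/eq_in_map => Q; rewrite mem_enum => /imsetP[a].
  rewrite !inE => /andP[aP _] ->; rewrite /nim; congr nim_rec.
  have -> : ~: (a |: P) = (~: P) :\ a by apply/setP=> x; rewrite !inE negb_or.
  by move: cP; rewrite (cardsD1 a) inE aP => -[].
have -> : Opt G W P = set0.
  apply/setP => Q; rewrite inE; apply/negP => /imsetP[a].
  by rewrite (cards0_eq cP) !inE.
rewrite /image_mem enum_set0 /= /mex.
by case: ex_minnP => m _ /(_ 0 isT); rewrite leqn0 => /eqP.
Qed.

Definition nim_DNG (S : finType) (G : convex_geometry S) (W : {set S}) : nat :=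
  nim G W set0.

(* Main.v *)
Require Import Defs.
From HB Require Import structures.
From mathcomp Require Import all_boot.

(** An extreme point w of the whole space lies in the hull of P only if it
    lies in P itself, since otherwise P is contained in S \ {w}, whose hull
    misses w.  Hence, when all points of W are extreme, the hull of P contains
    W exactly when P does ([sub_tau_Ex]), and the avoidance game only forbids
    completing W.  Every play then ends with exactly one point of S unchosen,
    that point being in W: as long as P misses some w in W and another point
    besides, that other point is a legal move.  So all plays have length
    #|S| - 1, and the nim number of a position is the parity of the number of
    moves left ([nim_Ex]).  In particular it is 0 or 1; both parities occur
    for the geometry in which every set is convex, with W the whole space
    ([nim_DNG_free]).  *)

Set Implicit Arguments.
Unset Strict Implicit.
Unset Printing Implicit Defensive.

Lemma mex_unique (s : seq nat) (m : nat) :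
  m \notin s -> (forall k, k < m -> k \in s) -> mex s = m.
Proof.
move=> ms lts; rewrite /mex; case: ex_minnP => k ks kmin.
apply/eqP; rewrite eqn_leq kmin //= leqNgt.
by apply: contra ks => /lts.
Qed.

Lemma mex_const_bool (s : seq nat) (b : bool) (x : nat) :
  x \in s -> (forall y, y \in s -> y = b) -> mex s = ~~ b.
Proof.
move=> xs sb; have bs : nat_of_bool b \in s by rewrite -(sb x).
apply: mex_unique => [|k]; first by apply/negP => /sb; case: (b).
by case: b bs {sb} => // bs; case: k.
Qed.

Lemma sub_tau (S : finType) (G : convex_geometry S) (A : {set S}) :
  A \subset tau G A.
Proof. by apply/bigcapsP => K /andP[]. Qed.

Lemma tauS (S : finType) (G : convex_geometry S) (A B : {set S}) :
  A \subset B -> tau G A \subset tau G B.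
Proof.
move=> AB; apply/bigcapsP => K /andP[KG BK].
by apply: bigcap_inf; rewrite KG (subset_trans AB BK).
Qed.

Lemma tau_convex (S : finType) (G : convex_geometry S) (A : {set S}) :
  A \in (G : {set {set S}}) -> tau G A = A.
Proof.
move=> AG; apply/eqP; rewrite eqEsubset sub_tau andbT.
by apply: bigcap_inf; rewrite AG subxx.
Qed.

Lemma mem_tau_Ex (S : finType) (G : convex_geometry S) (P : {set S}) (w : S) :
  w \in Ex G [set: S] -> (w \in tau G P) = (w \in P).
Proof.
rewrite inE in_setT /= => wE; apply/idP/idP => [|/(subsetP (sub_tau G P))//].
apply: contraLR => wP; apply: contra wE; apply: subsetP.
by apply: tauS; rewrite subsetD1 subsetT.
Qed.

Lemma sub_tau_Ex (S : finType) (G : convex_geometry S) (W P : {set S}) :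
  W \subset Ex G [set: S] -> (W \subset tau G P) = (W \subset P).
Proof.
move=> /subsetP WE; apply/subsetP/subsetP => WP w wW.
  by rewrite -(mem_tau_Ex P (WE w wW)) WP.
by rewrite mem_tau_Ex ?WP ?WE.
Qed.

(** The number of moves left from P is #|~: P| - 1 whatever the players do,
    and the options of a position with a forced number of moves left all have
    the same nim number.  *)
Lemma nim_Ex (S : finType) (G : convex_geometry S) (W P : {set S}) :
  W \subset Ex G [set: S] -> ~~ (W \subset P) ->
  nim G W P = odd #|~: P|.-1.
Proof.
move=> WE; have [n] := ubnP #|~: P|; elim: n P => // n IHn P ltPn WP.
have optP Q : Q \in Opt G W P ->
    nim G W Q = odd #|~: P|.-2.
  case/imsetP => a; rewrite !inE sub_tau_Ex // => /andP[aP WQ] defQ.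
  have cP : #|~: P| = #|~: Q|.+1.
    by rewrite (cardsD1 a) inE aP setDE -setCU setUC -defQ.
  by rewrite IHn defQ // -defQ ?cP // -ltnS -cP.
have [w wW wP] := subsetPn WP.
have cP : #|~: P| = #|~: P :\ w|.+1 by rewrite (cardsD1 w) inE wP.
rewrite nimE; have [Pw0 | [a]] := set_0Vmem (~: P :\ w).
  (* Only w is left, and choosing it is illegal. *)
  rewrite cP Pw0 cards0 /=; apply: mex_unique => //.
  apply/negP => /imageP[Q /imsetP[a]]; rewrite !inE sub_tau_Ex //.
  case/andP=> aP WQ _ _; have := in_set0 a; rewrite -Pw0 !inE aP andbT.
  move/negbFE/eqP => aw; case/negP: WQ; rewrite aw.
  apply/subsetP => x _; have := in_set0 x; rewrite -Pw0 !inE.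
  by case: eqP => //= _ /negbFE.
rewrite !inE => /andP[aw aP].
have aQ : a |: P \in Opt G W P.
  apply/imsetP; exists a => //; rewrite !inE aP sub_tau_Ex //=.
  by apply/subsetPn; exists w; rewrite // !inE negb_or eq_sym aw.
rewrite (@mex_const_bool _ (odd #|~: P|.-2) (nim G W (a |: P))).
- by rewrite cP (cardsD1 a) !inE aw aP.
- exact: image_f.
- by move=> y /imageP[Q /optP + ->].
Qed.

Lemma nim_DNG_Ex (S : finType) (G : convex_geometry S) (W : {set S}) :
  W != set0 -> W \subset Ex G [set: S] -> nim_DNG G W = odd #|S|.-1.
Proof. by move=> W0 WE; rewrite /nim_DNG nim_Ex ?subset0 // setC0 cardsT. Qed.

Section FreeGeometry.

Variable S : finType.

Fact free_setU1 (K : {set S}) :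
  K \in [set: {set S}] -> K != [set: S] ->
  exists2 a : S, a \notin K & a |: K \in [set: {set S}].
Proof.
rewrite -subTset => _ /subsetPn[a _ aK].
by exists a; rewrite ?in_setT.
Qed.

Definition free_geometry : convex_geometry S :=
  ConvexGeometry (in_setT [set: S])
    (fun K L _ _ => in_setT (K :&: L)) free_setU1.

Lemma Ex_free (A : {set S}) : Ex free_geometry A = A.
Proof.
apply/setP => a; rewrite inE tau_convex; last exact: in_setT.
by rewrite !inE eqxx andbT.
Qed.

End FreeGeometry.

Lemma nim_DNG_free (n : nat) :
  nim_DNG (free_geometry 'I_n.+1) [set: 'I_n.+1] = odd n.
Proof.
rewrite nim_DNG_Ex ?Ex_free ?card_ord //.
by apply/set0Pn; exists ord0.
Qed.

Theorem corollary24 :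
  forall n : nat,
    (exists (S : finType) (G : convex_geometry S) (W : {set S}),
       [/\ W != set0, tau G W \subset Ex G [set: S] & nim_DNG G W = n])
    <-> n = 0 \/ n = 1.
Proof.
move=> n; split=> [[S [G [W [W0 WE <-]]]]|n01].
  rewrite nim_DNG_Ex //; first by case: odd; [right | left].
  exact: subset_trans (sub_tau G W) WE.
exists 'I_n.+1, (free_geometry 'I_n.+1), [set: 'I_n.+1]; split.
- by apply/set0Pn; exists ord0.
- by rewrite Ex_free subsetT.
- by rewrite nim_DNG_free; case: n01 => ->.
Qed.
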